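(* For all integers $m\ge 1$ and $r,q\geq 2$, $$S_{r^m,q}=\sum_{l=0}^m\sum_{\eta\in\mathcal{C}_l}(-1)^l\binom{m}{l}\binom{l}{\eta_1,\eta_2,\ldots,\eta_p}\zeta(r)^{m-l}\,\zeta(r\eta_1,r\eta_2,\ldots,r\eta_p,q),$$ where $\eta=(\eta_1,\eta_2,\ldots,\eta_p)$ and $p$ is the number of parts of $\eta$.
   Context: Generalized harmonic numbers: $H_n^{(r)}=\sum_{k=1}^n k^{-r}$ for positive integers $n,r$. Euler sum: $S_{r^m,q}=\sum_{n=1}^{\infty}\frac{(H_n^{(r)})^m}{n^q}$. Multiple zeta values: for positive integers $s_1,\ldots,s_k$ with $s_1>1$, $\zeta(s_1,s_2,\ldots,s_k)=\sum_{n_1>n_2>\cdots>n_k\geq 1}\frac{1}{n_1^{s_1}n_2^{s_2}\cdots n_k^{s_k}}$; for $k=1$ this is the Riemann zeta value. A composition of $l$ is an ordered tuple of positive integers whose elements sum to $l$; $\mathcal{C}_l$ is the set of all compositions of $l$. Multinomial coefficients: $\binom{l}{\eta_1,\eta_2,\ldots,\eta_p}=\frac{l!}{\eta_1!\,\eta_2!\cdots\eta_p!}$. Convention for $l=0$: $\mathcal{C}_0$ consists of the empty composition ($p=0$), the multinomial coefficient is $1$, and the corresponding summand is $\zeta(r)^m\zeta(q)$. *)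

(* Defs.v *)
From mathcomp Require Import all_boot all_order all_algebra.
From mathcomp Require Import all_classical all_reals all_analysis.

Set Implicit Arguments.
Unset Strict Implicit.
Unset Printing Implicit Defensive.

Import Order.TTheory GRing.Theory Num.Theory.

Local Open Scope classical_set_scope.
Local Open Scope ring_scope.

Definition gen_harmonic (R : realType) (r n : nat) : R :=
  \sum_(1 <= k < n.+1) k%:R ^- r.

(* Valued in \bar R, where a series of nonnegative terms always has a sum, so
   that an equation [euler_sum R r m q = x%:E] also asserts convergence. *)
Definition euler_sum (R : realType) (r m q : nat) : \bar R :=
  (\sum_(1 <= n <oo) (gen_harmonic R r n ^+ m / n%:R ^+ q)%:E)%E.

(* [mzv R [:: s_1; ...; s_k]] is zeta(s_1, ..., s_k), the unordered sum of a
   nonnegative family over the tuples n_1 > ... > n_k >= 1.  It is finite when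
   s_1 > 1 and all s_i > 0; [fine] sends a divergent sum to 0. *)
Definition mzv (R : realType) (s : seq nat) : R :=
  fine (\esum_(n in [set n : (size s).-tuple nat |
                       sorted gtn n && all (leq 1) n])
          (\prod_(i < size s) (tnth n i)%:R ^- nth 0%N s i)%:E)%E.

Definition compositions (l : nat) : set (seq nat) :=
  [set eta | all (leq 1) eta /\ sumn eta = l].

(* The sums [\sum_(eta \in compositions l) _] below are finite-support sums,
   which are the intended ones because of this lemma. *)
Lemma finite_compositions (l : nat) : finite_set (compositions l).
Proof.
have [n] := ubnP l; elim: n l => // n IHn l ltln.
pose S := [set [::]] `|`
  \bigcup_(k in `I_l) [set ((l - k)%N :: eta) | eta in compositions k].
apply: (@sub_finite_set _ _ S); last first.
  rewrite finite_setU; split; first exact: finite_set1.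
  apply: bigcup_finite; first exact: finite_II.
  move=> k /= ltkl; apply: finite_image; apply: IHn.
  exact: leq_trans ltkl _.
move=> [|a eta] [/= h sE]; [by left|right].
move: h => /andP[a0 h].
exists (sumn eta); first by rewrite /= -sE -[X in (X < _)%N]add0n ltn_add2r.
by exists eta => //; rewrite -sE addnK.
Qed.

(* Division in R; it is exact when eta is a composition of l. *)
Definition multinomial (R : realType) (l : nat) (eta : seq nat) : R :=
  l`!%:R / (\prod_(e <- eta) e`!)%:R.

(* Main.v *)
(* Let T_n be the sum of k^(-r) over k > n, so that H_n^(r) = zeta(r) - T_n; the
   binomial theorem reduces the claim to the expansion of T_n^l as the sum over
   eta in C_l of multinomial(eta) times the part of zeta(r eta_1, ..., r eta_p)
   over n_1 > ... > n_p > n.  By strong induction on l: T_n^l is the telescoping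
   sum of the T_{k-1}^l - T_k^l over k > n, in which T_{k-1} = T_k + k^(-r) is
   expanded by the binomial theorem, and k becomes the smallest index n_p. *)

Require Import Defs.
From mathcomp Require Import all_boot all_order all_algebra.
From mathcomp Require Import all_classical all_reals all_analysis.
From mathcomp Require Import ring.

Import Order.TTheory GRing.Theory Num.Theory.
Import numFieldNormedType.Exports.

Local Open Scope classical_set_scope.
Local Open Scope ring_scope.

(** * Tails of multiple zeta values as sums over decreasing chains *)

Lemma ge0_esumZl {R : realType} {T : choiceType} (I : set T) (a : T -> \bar R)
    (c : R) : 0 <= c -> (forall i, (0 <= a i)%E) ->
  (c%:E * (\esum_(i in I) a i) = \esum_(i in I) (c%:E * a i))%E.
Proof.
move=> c0 a0; rewrite /esum -ereal_supZl//.
  rewrite image_comp; congr ereal_sup; apply/seteqP.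
  by split=> _ [X fX <-]; exists X; rewrite //= ge0_mule_fsumr.
by apply/set0P; eexists; exists set0; [exact: fsets_set0|].
Qed.

(** Plain sequences instead of tuples, so that appending a smallest entry needs no cast between
    sizes. The bound [n = 0] gives the index set of a full multiple zeta value. *)
Definition chains (k n : nat) : set (seq nat) :=
  [set t | size t = k /\ sorted gtn t && all (ltn n) t].

(* [etail_mzv R [:: s_1; ...; s_k] n] is the part of zeta(s_1, ..., s_k) over
   n_1 > ... > n_k > n. *)
Definition etail_mzv (R : realType) (s : seq nat) (n : nat) : \bar R :=
  (\esum_(t in chains (size s) n) (\prod_(p <- zip s t) p.2%:R ^- p.1)%:E)%E.

Lemma prod_tail_ge0 {R : realType} (s t : seq nat) :
  0 <= \prod_(p <- zip s t) p.2%:R ^- p.1 :> R.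
Proof. by apply: prodr_ge0 => p _; rewrite invr_ge0 exprn_ge0. Qed.

Lemma etail_mzv_ge0 {R : realType} s n : (0 <= etail_mzv R s n)%E.
Proof. by apply: esum_ge0 => t _; rewrite lee_fin prod_tail_ge0. Qed.

Lemma mzvE {R : realType} (s : seq nat) : mzv R s = fine (etail_mzv R s 0).
Proof.
rewrite /mzv /etail_mzv; congr fine.
rewrite (@reindex_esum R _ _ [set n : (size s).-tuple nat |
   sorted gtn n && all (leq 1) n] (chains (size s) 0) (@tval _ _)); last first.
  split.
  - by move=> t /= h; split=> //; rewrite size_tuple.
  - by move=> t u _ _ /val_inj.
  - by move=> t [/eqP st h]; exists (Tuple st).
apply: eq_esum => t _; congr EFin.
rewrite (big_nth (0%N, 0%N)) size_zip size_tuple minnn big_mkord.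
by apply: eq_bigr => i _; rewrite nth_zip ?size_tuple//= (tnth_nth 0%N).
Qed.

Lemma etail_mzv_nil {R : realType} n : etail_mzv R [::] n = 1%E.
Proof.
rewrite /etail_mzv (_ : chains _ _ = [set [::]]).
  by rewrite esum_set1 /= big_nil.
apply/seteqP; split=> [t [/size0nil->//]|_ ->]; by split.
Qed.

Lemma chains_rcons k n t x :
  chains k.+1 n (rcons t x) <-> (n < x)%N /\ chains k x t.
Proof.
rewrite /chains /= size_rcons all_rcons.
(* As [gtn] is transitive, sortedness is a pairwise condition, which splits at the last entry. *)
have -> : sorted gtn (rcons t x) = sorted gtn t && all (ltn x) t.
  have gt_trans : transitive gtn.
    by move=> y z w /= yz wy; exact: ltn_trans wy yz.
  by rewrite !(sorted_pairwise gt_trans) pairwise_rcons andbC.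
split.
  by move=> [[->] /andP[/andP[-> xt] /andP[nx _]]]; rewrite xt.
move=> [nx [-> /andP[-> xt]]]; split=> //.
rewrite xt /=; apply/andP; split=> //.
by apply: sub_all xt => y; apply: ltn_trans.
Qed.

(** Splits off the smallest index [k], which becomes the strict lower bound of the remaining chain.
    All terms are nonnegative, so the sum may be iterated in any order. *)
Lemma etail_mzv_rcons {R : realType} s a n :
  etail_mzv R (rcons s a) n =
  (\sum_(n.+1 <= k <oo) (k%:R ^- a)%:E * etail_mzv R s k)%E.
Proof.
rewrite eseries_cond nneseries_esum /=; last first.
  by move=> k _; rewrite mule_ge0 ?etail_mzv_ge0// lee_fin invr_ge0 exprn_ge0.
under eq_esum => k _.
  rewrite ge0_esumZl ?invr_ge0 ?exprn_ge0//; last first.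
    by move=> t; rewrite lee_fin prod_tail_ge0.
  over.
rewrite esum_esum /=; last first.
  move=> k t _ _.
  by rewrite mule_ge0// lee_fin ?prod_tail_ge0// invr_ge0 exprn_ge0.
rewrite /etail_mzv (@reindex_esum R _ _
   ([set k | (n < k)%N] `*`` chains (size s)) _ (fun p => rcons p.2 p.1)).
  apply: eq_esum => -[k t] /= [_ [st _]].
  by rewrite zip_rcons// -cats1 big_cat big_seq1 /= mulrC EFinM.
split.
- by move=> [k t] [/= nk kt]; rewrite size_rcons; apply/chains_rcons.
- by move=> [k t] [k' t'] _ _ /= /rcons_inj[-> ->].
- move=> t; case/lastP: t => [[]|t x]; rewrite size_rcons //.
  by move=> /chains_rcons[nx ct]; exists (x, t).
Qed.

(** * Finiteness when all exponents are at least 2 *)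

(** Induction using 1/(n+2)^2 <= 1/((n+1)(n+2)) = 1/(n+1) - 1/(n+2). *)
Lemma sum_inv_sqr_le {R : realType} (n : nat) :
  \sum_(1 <= k < n.+2) k%:R ^- 2 <= 2 - n.+1%:R^-1 :> R.
Proof.
elim: n => [|n IH]; first by rewrite big_nat1 expr1n invr1 lerBrDr.
rewrite big_nat_recr //=; apply: le_trans (lerD IH (lexx _)) _.
rewrite -addrA lerD2l.
have a0 : (0 : R) < n.+1%:R by [].
have b0 : (0 : R) < n.+2%:R by [].
have uv : n.+1%:R^-1 - n.+2%:R^-1 = n.+1%:R^-1 * n.+2%:R^-1 :> R.
  rewrite -[n.+2]addn1 natrD; field.
  by rewrite !(addrC 1) !natr1 !pnatr_eq0.
rewrite -lerBrDl opprK addrC uv expr2 invfM ler_wpM2r ?invr_ge0//.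
by rewrite lef_pV2 ?posrE// ler_nat.
Qed.

Lemma nneseries_invX_le {R : realType} (a n : nat) : (2 <= a)%N ->
  (\sum_(n.+1 <= k <oo) (k%:R ^- a)%:E <= 2%:E :> \bar R)%E.
Proof.
move=> a2.
have k0 (k : nat) b : (0 <= (k%:R ^- b)%:E :> \bar R)%E.
  by rewrite lee_fin invr_ge0 exprn_ge0.
apply: lime_le; first by apply: is_cvg_nneseries.
apply: nearW => N; rewrite sumEFin lee_fin.
(* The range is widened at both ends so that [sum_inv_sqr_le] applies for every [N], including 0. *)
apply: (@le_trans _ _ (\sum_(1 <= k < N.+2) k%:R ^- 2)).
  rewrite (@big_nat_widenl _ _ _ _ 1)//.
  rewrite (@big_nat_widen _ _ _ 1 N N.+2) ?(leqW (leqnSn N))//.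
  rewrite big_mkcond /=; apply: ler_sum_nat => k /andP[k1 _].
  case: ifP => _; last by rewrite invr_ge0 exprn_ge0.
  by rewrite lef_pV2 ?posrE ?exprn_gt0 ?ltr0n// ler_weXn2l// ler1n.
by apply: le_trans (sum_inv_sqr_le N) _; rewrite gerBl invr_ge0.
Qed.

Lemma etail_mzv_fin_num {R : realType} (s : seq nat) (n : nat) :
  all (leq 2) s -> etail_mzv R s n \is a fin_num.
Proof.
(* Each summation contributes a factor of at most 2. The bound is uniform in [n], so the induction
   hypothesis covers the inner tails at every [k]. *)
move=> s2; suff h : (etail_mzv R s n <= (2 ^+ size s)%:E)%E.
  by rewrite ge0_fin_numE ?etail_mzv_ge0// (le_lt_trans h) ?ltry.
elim/last_ind: s n s2 => [|s a IH] n; first by rewrite etail_mzv_nil.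
rewrite all_rcons => /andP[a2 s2].
rewrite etail_mzv_rcons size_rcons exprSr EFinM.
apply: (@le_trans _ _
    (\sum_(n.+1 <= k <oo) (2 ^+ size s)%:E * (k%:R ^- a)%:E)%E).
  apply: lee_nneseries => [k _ _|k _].
    by rewrite mule_ge0 ?etail_mzv_ge0// lee_fin invr_ge0 exprn_ge0.
  by rewrite muleC lee_pmul ?etail_mzv_ge0 ?IH// lee_fin invr_ge0 exprn_ge0.
rewrite nneseriesZl; last by move=> k _; rewrite lee_fin invr_ge0 exprn_ge0.
by rewrite lee_pmul2l ?lte_fin ?exprn_gt0// nneseries_invX_le.
Qed.

(** Real-valued, to allow subtraction and ring identities. [fine] would send an infinite tail to 0;
    [tail_mzvK] rules this out for exponents at least 2. *)
Definition tail_mzv (R : realType) (s : seq nat) (n : nat) : R :=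
  fine (etail_mzv R s n).

Lemma tail_mzvK {R : realType} s n : all (leq 2) s ->
  (tail_mzv R s n)%:E = etail_mzv R s n.
Proof. by move=> s2; rewrite fineK// etail_mzv_fin_num. Qed.

Lemma cvg_tail_mzv_rcons {R : realType} s a n : all (leq 2) s -> (2 <= a)%N ->
  (\sum_(n.+1 <= k < N) k%:R ^- a * tail_mzv R s k) @[N --> \oo]
    --> tail_mzv R (rcons s a) n.
Proof.
move=> s2 a2.
have h : (\sum_(n.+1 <= k < N) (k%:R ^- a)%:E * etail_mzv R s k)%E @[N --> \oo]
    --> (tail_mzv R (rcons s a) n)%:E.
  rewrite tail_mzvK ?all_rcons ?a2// etail_mzv_rcons.
  apply: is_cvg_nneseries => k _ _.
  by rewrite mule_ge0 ?etail_mzv_ge0// lee_fin invr_ge0 exprn_ge0.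
rewrite (_ : (fun N => _) = fine \o
  (fun N => \sum_(n.+1 <= k < N) (k%:R ^- a)%:E * etail_mzv R s k)%E).
  exact: fine_cvg h.
apply/funext => N /=.
rewrite (eq_bigr (fun k => (k%:R ^- a * tail_mzv R s k)%:E)).
  by rewrite sumEFin.
by move=> k _; rewrite EFinM tail_mzvK.
Qed.

(** * Limits of finite sums, and sums over compositions *)

Lemma cvg_sumr {R : realType} {I T : Type} (F : set_system T) {FF : Filter F}
    (s : seq I) (P : pred I) (f : I -> T -> R) (a : I -> R) :
  (forall i, P i -> f i x @[x --> F] --> a i) ->
  (\sum_(i <- s | P i) f i x) @[x --> F] --> \sum_(i <- s | P i) a i.
Proof.
by apply: cvg_big => x; apply: continuousD; [exact: cvg_fst|exact: cvg_snd].
Qed.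

Lemma cvg_fsum {R : realType} {I : choiceType} {T : Type} (F : set_system T)
    {FF : Filter F} (D : set I) (f : I -> T -> R) (a : I -> R) :
  finite_set D -> (forall i, D i -> f i x @[x --> F] --> a i) ->
  (\sum_(i \in D) f i x) @[x --> F] --> \sum_(i \in D) a i.
Proof.
move=> fD fa; rewrite fsbig_finite//= big_seq.
under eq_cvg do rewrite fsbig_finite//= big_seq.
by apply: cvg_sumr => i; rewrite in_fset_set// inE; exact: fa.
Qed.

(** A composition of [l.+1] is nonempty; removing its last part [j.+1] leaves a composition of
    [l - j]. The last part is the one attached to the smallest index of a chain. *)
Lemma fsum_compositionsS {R : realType} (l : nat) (F : seq nat -> R) :
  \sum_(eta \in compositions l.+1) F eta =
  \sum_(j < l.+1) \sum_(eta \in compositions (l - j)) F (rcons eta j.+1).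
Proof.
(* Each [eta] is counted once, at the [j] with [j.+1] its last part; then the two sums are
   exchanged. *)
transitivity (\sum_(eta \in compositions l.+1) \sum_(j < l.+1)
    if eta \in [set eta | last 0%N eta = j.+1] then F eta else 0).
  apply: eq_fsbigr => eta; rewrite inE => -[].
  case/lastP: eta => [//|eta a].
  rewrite /= all_rcons sumn_rcons => /andP[a0 _] sl.
  have al : (a.-1 < l.+1)%N by rewrite prednK// -sl leq_addl.
  rewrite (bigD1 (Ordinal al))//= mem_set/= ?last_rcons ?prednK// big1 ?addr0//.
  move=> j jl; rewrite memNset//= last_rcons => aj.
  by case/eqP: jl; apply/val_inj; rewrite /= aj.
rewrite fsbig_finite/=; last exact: finite_compositions.
rewrite exchange_big; apply: eq_bigr => j _ /=.
rewrite -fsbig_finite/=; last exact: finite_compositions.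
rewrite -fsbig_mkcondr.
apply: (@reindex_fsbig _ _ _ _ _ (fun eta => rcons eta j.+1)); split.
- move=> eta [h s] /=.
  rewrite /compositions /= last_rcons all_rcons sumn_rcons s h.
  by do !split; rewrite addnS subnK// -ltnS.
- by move=> eta eta' _ _ /rcons_inj[].
- move=> eta [[]]; case/lastP: eta => // eta a.
  rewrite /= all_rcons sumn_rcons last_rcons => /andP[_ h] s /= aj.
  exists eta; last by rewrite aj.
  split=> //; move: s.
  by rewrite aj addnS => /succn_inj/(congr1 (subn^~ j)); rewrite addnK.
Qed.

Lemma multinomial_rcons {R : realType} (l j : nat) (eta : seq nat) :
  (j <= l)%N ->
  multinomial R l (rcons eta j) = 'C(l, j)%:R * multinomial R (l - j) eta.
Proof.
move=> jl; rewrite /multinomial -cats1 big_cat big_seq1 /= natrM invfM.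
rewrite -(bin_fact jl) !natrM.
have j0 : j`!%:R != 0 :> R by rewrite pnatr_eq0 -lt0n fact_gt0.
by set p := (\prod_(e <- eta) _)%:R^-1; field.
Qed.

(** * Tails of the series of zeta(r) and their powers *)

Lemma cvg_tail_zeta {R : realType} (r n : nat) : (2 <= r)%N ->
  (\sum_(n.+1 <= k < N) k%:R ^- r) @[N --> \oo] --> tail_mzv R [:: r] n.
Proof.
move=> r2; rewrite (_ : (fun N => _) =
    fun N => \sum_(n.+1 <= k < N) k%:R ^- r * tail_mzv R [::] k).
  exact: (@cvg_tail_mzv_rcons R [::] r n isT r2).
apply/funext => N; apply: eq_bigr => k _.
by rewrite /tail_mzv etail_mzv_nil mulr1.
Qed.

Lemma tail_zetaE {R : realType} (r n : nat) : (2 <= r)%N ->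
  tail_mzv R [:: r] n = tail_mzv R [:: r] 0 - gen_harmonic R r n.
Proof.
move=> r2; apply: (cvg_unique _ (cvg_tail_zeta r n r2)) => //.
apply: cvg_trans (cvgB (cvg_tail_zeta r 0 r2) (cvg_cst (gen_harmonic R r n))).
apply: near_eq_cvg; near=> N.
transitivity (\sum_(1 <= k < N) k%:R ^- r - gen_harmonic R r n) => //.
(* Cutting the sum at [n.+1] requires [n < N], hence the passage to large [N]. *)
rewrite /gen_harmonic (@big_cat_nat _ _ _ n.+1 1 N)//=; first last.
  by near: N; exact: nbhs_infty_ge.
by rewrite addrAC subrr add0r.
Unshelve. all: by end_near. Qed.

Lemma tail_zetaS {R : realType} (r n : nat) : (2 <= r)%N ->
  tail_mzv R [:: r] n = tail_mzv R [:: r] n.+1 + n.+1%:R ^- r.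
Proof.
move=> r2; rewrite (tail_zetaE r n r2) (tail_zetaE r n.+1 r2).
rewrite /gen_harmonic [in RHS]big_nat_recr//=.
by rewrite opprD addrA subrK.
Qed.

Lemma cvg_tail_zeta0 {R : realType} (r : nat) : (2 <= r)%N ->
  tail_mzv R [:: r] n @[n --> \oo] --> 0.
Proof.
move=> r2; rewrite -(subrr (tail_mzv R [:: r] 0)).
under eq_cvg do rewrite (tail_zetaE r _ r2).
apply: cvgB; first exact: cvg_cst.
(* The harmonic number at [n] is the partial sum with excluded bound [n.+1], hence the shift. *)
by have := @cvg_tail_zeta R r 0 r2; rewrite -cvg_shiftS; exact.
Qed.

Lemma all_map_muln (r l : nat) (eta : seq nat) : (2 <= r)%N ->
  compositions l eta -> all (leq 2) (map (muln r) eta).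
Proof.
move=> r2 [+ _]; rewrite all_map; apply: sub_all => e e0 /=.
by rewrite (leq_trans r2)// leq_pmulr.
Qed.

Lemma tail_zetaX {R : realType} (r l n : nat) : (2 <= r)%N ->
  tail_mzv R [:: r] n ^+ l =
  \sum_(eta \in compositions l)
    multinomial R l eta * tail_mzv R (map (muln r) eta) n.
Proof.
move=> r2; elim/ltn_ind: l n => -[|l] IH n.
  rewrite (_ : compositions 0 = [set [::]]).
    by rewrite fsbig_set1 /multinomial big_nil divr1 mul1r /tail_mzv
      etail_mzv_nil.
  apply/seteqP; split=> [[//|[//|a] eta] []//|_ ->]; by split.
pose T := tail_mzv R [:: r].
(* The binomial term without a factor k.+1^(-r) cancels. In the others the power of [T k.+1] is
   [l - j], below [l.+1], so the induction hypothesis applies, and [multinomial_rcons] absorbs the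
   binomial coefficient. *)
have step k : T k ^+ l.+1 - T k.+1 ^+ l.+1 =
    \sum_(j < l.+1) \sum_(eta \in compositions (l - j))
      multinomial R l.+1 (rcons eta j.+1) *
      (k.+1%:R ^- (r * j.+1) * tail_mzv R (map (muln r) eta) k.+1).
  rewrite {1}/T tail_zetaS// -/T exprDn big_ord_recl /= expr0 mulr1 subn0 bin0.
  rewrite mulr1n addrC addKr; apply: eq_bigr => j _.
  rewrite /bump /= add1n subSS /T IH ?ltnS ?leq_subr// -mulr_natr.
  rewrite !mulr_fsuml; apply: eq_fsbigr => eta _.
  rewrite (multinomial_rcons _ _ _ (ltn_ord j)) subSS exprM exprVn.
  by rewrite -!mulrA; ring.
(* For [n <= N] the sum telescopes to [T n ^+ l.+1 - T N ^+ l.+1], and the second term tends to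
   0. *)
have cvgl : (\sum_(n.+1 <= k < N.+1) (T k.-1 ^+ l.+1 - T k ^+ l.+1))
    @[N --> \oo] --> T n ^+ l.+1.
  have h : (T N ^+ l.+1) @[N --> \oo] --> (0 : R) ^+ l.+1.
    exact: (cvg_comp _ _ (cvg_tail_zeta0 r r2) (@exprn_continuous R l.+1 0)).
  rewrite expr0n in h.
  rewrite -[X in _ --> X]subr0; apply: cvg_trans (cvgB (cvg_cst _) h).
  apply: near_eq_cvg; near=> N.
  transitivity (T n ^+ l.+1 - T N ^+ l.+1) => //.
  rewrite big_add1 /= -opprB -(@telescope_sumr _ _ _ (fun k => T k ^+ l.+1)).
    by rewrite -sumrN; apply: eq_bigr => k _; rewrite opprB.
  by near: N; exact: nbhs_infty_ge.
apply: (cvg_unique _ cvgl) => //.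
rewrite fsum_compositionsS.
(* The sums over [j] and [eta] are finite, so they move outside the partial sum over [k] before any
   limit is taken. *)
rewrite (_ : (fun N => _) = fun N => \sum_(j < l.+1)
    \sum_(eta \in compositions (l - j)) multinomial R l.+1 (rcons eta j.+1) *
      \sum_(n.+1 <= k < N.+1)
        k%:R ^- (r * j.+1) * tail_mzv R (map (muln r) eta) k); last first.
  apply/funext => N.
  transitivity (\sum_(n.+1 <= k < N.+1) \sum_(j < l.+1)
      \sum_(eta \in compositions (l - j)) multinomial R l.+1 (rcons eta j.+1) *
        (k%:R ^- (r * j.+1) * tail_mzv R (map (muln r) eta) k)).
    apply: eq_big_nat => k /andP[nk _].
    by rewrite -[in LHS](ltn_predK nk) step (ltn_predK nk).
  rewrite exchange_big; apply: eq_bigr => j _.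
  pose fsumE := fsbig_finite _ _ (finite_compositions (l - j)).
  rewrite [RHS]fsumE; under eq_bigr do rewrite fsumE.
  by rewrite exchange_big; apply: eq_bigr => eta _; rewrite mulr_sumr.
apply: cvg_sumr => j _; apply: cvg_fsum; first exact: finite_compositions.
move=> eta cet; apply: cvgMl_tmp; rewrite map_rcons.
(* Here [k] becomes the smallest index, with exponent [r * j.+1]; the shift accounts for the
   excluded bound [N.+1]. *)
have := @cvg_tail_mzv_rcons R (map (muln r) eta) (r * j.+1) n.
rewrite -cvg_shiftS; apply; first exact: all_map_muln cet.
by rewrite (leq_trans r2)// leq_pmulr.
Unshelve. all: by end_near. Qed.

Theorem theorem3p6 (R : realType) (m r q : nat)
    (hm : (1 <= m)%N) (hr : (2 <= r)%N) (hq : (2 <= q)%N) :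
  euler_sum R r m q =
  (\sum_(0 <= l < m.+1) \sum_(eta \in compositions l)
     (-1) ^+ l * 'C(m, l)%:R * multinomial R l eta *
     mzv R [:: r] ^+ (m - l) * mzv R (rcons (map (muln r) eta) q))%:E.
Proof.
(* The binomial theorem for zeta(r) - T_n, with [tail_zetaX] applied to each power of T_n. *)
have harmonicX n : gen_harmonic R r n ^+ m / n%:R ^+ q =
    \sum_(l < m.+1) \sum_(eta \in compositions l)
      ((-1) ^+ l * 'C(m, l)%:R * multinomial R l eta *
         mzv R [:: r] ^+ (m - l)) *
        (n%:R ^- q * tail_mzv R (map (muln r) eta) n).
  have -> : gen_harmonic R r n = mzv R [:: r] - tail_mzv R [:: r] n.
    by rewrite tail_zetaE// mzvE opprB addrC subrK.
  rewrite exprBn mulr_suml; apply: eq_bigr => l _.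
  rewrite (tail_zetaX _ _ _ hr) mulr_fsumr -mulr_natr !mulr_fsuml.
  by apply: eq_fsbigr => eta _; ring.
(* Only finite sums are exchanged below, at the level of real partial sums; the limit is then taken
   term by term. *)
rewrite /euler_sum; apply/cvg_lim => //.
rewrite (_ : (fun N => _) = EFin \o (fun N => \sum_(l < m.+1)
    \sum_(eta \in compositions l)
      ((-1) ^+ l * 'C(m, l)%:R * multinomial R l eta *
         mzv R [:: r] ^+ (m - l)) *
        \sum_(1 <= n < N) n%:R ^- q * tail_mzv R (map (muln r) eta) n));
  last first.
  apply/funext => N; rewrite sumEFin /=; congr EFin.
  rewrite (eq_bigr _ (fun n _ => harmonicX n)) exchange_big.
  apply: eq_bigr => l _.
  pose fsumE := fsbig_finite _ _ (finite_compositions l).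
  rewrite [RHS]fsumE; under eq_bigr do rewrite fsumE.
  by rewrite exchange_big; apply: eq_bigr => eta _; rewrite mulr_sumr.
apply: cvg_EFin; first exact: nearW.
rewrite big_mkord; apply: cvg_sumr => l _.
apply: cvg_fsum; first exact: finite_compositions.
(* The summation index [n] of the Euler sum becomes the smallest index, with exponent [q]; the tail
   above 0 is the full multiple zeta value. *)
move=> eta ceta; apply: cvgMl_tmp; rewrite mzvE.
by apply: cvg_tail_mzv_rcons => //; exact: all_map_muln ceta.
Qed.
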